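(* Let $X$ and $Y$ be real Banach spaces such that $X$ is reflexive, let $A\colon X\to Y$ be a bounded linear operator with closed range, and let $b\in Y$. Then every point $\bar x\in X$ satisfying the affine equality constraint $A\bar x=b$ is w-AKKT regular for this constraint.
   Context: The constraint $Ax=b$ is viewed as $G(x)\in K$, $x\in C$ with $C:=X$, $K:=\{0\}\subset Y$, $G(x):=Ax-b$. For $x\in X$ and $r\ge0$ let $$\mathcal M(x,r):=\{A^*\lambda\in X^*\mid\lambda\in Y^*,\ -\langle\lambda,Ax-b\rangle_Y\le r\}$$ (this is the set $\{G'(x)^*\lambda+\mu\mid\lambda\in Y^*,\ \mu\in\mathcal N_C(x),\ \langle\lambda,y-G(x)\rangle_Y\le r\ \forall y\in K\}$ in this setting, where $\mathcal N_C(x)$ is the normal cone of convex analysis). A feasible point $\bar x$ is w-AKKT regular if every $\bar v\in X^*$ for which there exist sequences $\{x^k\}\subset X$, $\{r^k\}\subset[0,+\infty)$, $\{v^k\}\subset X^*$ with $x^k\rightharpoonup\bar x$ (weakly), $r^k\to0$, $v^k\rightharpoonup^*\bar v$ (weak* ) and $v^k\in\mathcal M(x^k,r^k)$ for all $k$ belongs to $\mathcal M(\bar x,0)$. *)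

(* Defs.v *)
From HB Require Import structures.
From mathcomp Require Import all_boot all_order all_algebra.
From mathcomp Require Import all_classical all_reals topology normedtype sequences.

Set Implicit Arguments.
Unset Strict Implicit.
Unset Printing Implicit Defensive.

Import Order.TTheory GRing.Theory Num.Theory.
Import numFieldNormedType.Exports.

Local Open Scope classical_set_scope.
Local Open Scope ring_scope.

(* The library has no type of bounded linear operators and no dual space, so
   L(V, W) is built here as a subtype of V -> W and equipped with the operator
   norm. *)
Section BoundedLinear.
Context {R : realType} {V W : normedModType R}.

(* For linear maps, bounded_fun_norm (boundedness on balls) is boundedness in
   the usual sense, equivalently continuity. *)
Definition blin_pred : {pred V -> W} :=
  [pred f | `[< linear f /\ bounded_fun_norm f >]].

Record blin := BLin { blin_fun :> V -> W; _ : blin_fun \in blin_pred }.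

HB.instance Definition _ := [isSub for blin_fun].
HB.instance Definition _ := [Choice of blin by <:].

Lemma blin_linear (f : blin) : linear f.
Proof. by case: f => f /= /asboolP[]. Qed.

Lemma blin_bounded (f : blin) : bounded_fun_norm f.
Proof. by case: f => f /= /asboolP[]. Qed.

HB.instance Definition _ (f : blin) :=
  GRing.isLinear.Build R V W *:%R f (blin_linear f).

Lemma blin_continuous (f : blin) : continuous f.
Proof.
by apply: bounded_linear_continuous; apply/bounded_funP; exact: blin_bounded.
Qed.

Lemma blin_ext (f g : blin) : (forall x, f x = g x) -> f = g.
Proof. by move=> fg; apply/val_inj/funext. Qed.

Let blin_submod : submod_closed blin_pred.
Proof.
split=> [|a f g /asboolP[lf bf] /asboolP[lg bg]]; apply/asboolP; split.
- by move=> a x y /=; rewrite scaler0 addr0.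
- by move=> r; exists 0 => x _; rewrite normr0.
- by move=> c x y; rewrite !fctE lf lg !scalerDr !scalerA mulrC addrACA.
- move=> r; have [M fM] := bf r; have [N gN] := bg r.
  exists (`|a| * M + N) => x xr; rewrite (le_trans (ler_normD _ _))//.
  rewrite lerD ?gN//.
  by rewrite (_ : (a *: f) x = a *: f x)// normrZ ler_wpM2l ?fM.
Qed.

HB.instance Definition _ :=
  GRing.isSubmodClosed.Build R (V -> W) blin_pred blin_submod.
HB.instance Definition _ := [SubChoice_isSubLmodule of blin by <:].

Definition op_norm (f : blin) : R := sup [set `|f x| | x in [set x | `|x| <= 1]].

Let op_norm_has_sup (f : blin) :
  has_sup [set `|f x| | x in [set x | `|x| <= 1]].
Proof.
split; first by exists `|f 0|, 0 => //=; rewrite normr0.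
by have [M fM] := blin_bounded f 1; exists M => _ [x /= x1 <-]; exact: fM.
Qed.

Let op_norm_ub (f : blin) x : `|x| <= 1 -> `|f x| <= op_norm f.
Proof.
move=> x1; apply: ub_le_sup; first by case: (op_norm_has_sup f).
by exists x.
Qed.

Let op_norm_le (f : blin) c :
  (forall x, `|x| <= 1 -> `|f x| <= c) -> op_norm f <= c.
Proof.
move=> fc; apply: ge_sup; first by case: (op_norm_has_sup f).
by move=> _ [x /= x1 <-]; exact: fc.
Qed.

Lemma op_normP (f : blin) x : `|f x| <= op_norm f * `|x|.
Proof.
have [->|x0] := eqVneq x 0; first by rewrite linear0 !normr0 mulr0.
rewrite -ler_pdivrMr ?normr_gt0// mulrC.
rewrite -[X in X * _](ger0_norm (_ : 0 <= `|x|^-1)) ?invr_ge0// -normrZ -linearZ.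
by apply: op_norm_ub; rewrite normrZ normfV normr_id mulVf ?normr_eq0.
Qed.

Let op_norm_ge0 (f : blin) : 0 <= op_norm f.
Proof.
by apply: le_trans (op_norm_ub f (x := 0) _) => //; rewrite normr0.
Qed.

Let op_normD (f g : blin) : op_norm (f + g) <= op_norm f + op_norm g.
Proof.
apply: op_norm_le => x x1; rewrite (le_trans (ler_normD (f x) (g x)))//.
by rewrite lerD ?op_norm_ub.
Qed.

Let op_normZ (a : R) (f : blin) : op_norm (a *: f) = `|a| * op_norm f.
Proof.
have le b (g : blin) : op_norm (b *: g) <= `|b| * op_norm g.
  apply: op_norm_le => x x1.
  by rewrite (_ : (b *: g) x = b *: g x)// normrZ ler_wpM2l ?op_norm_ub.
apply/eqP; rewrite eq_le le/=.
have [->|a0] := eqVneq a 0; first by rewrite normr0 mul0r op_norm_ge0.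
rewrite -ler_pdivlMl ?normr_gt0// -normfV.
by rewrite -[X in op_norm X <= _](scalerK a0) le.
Qed.

Let op_norm0_eq0 (f : blin) : op_norm f = 0 -> f = 0.
Proof.
move=> f0; apply: blin_ext => x; apply/eqP; rewrite -normr_le0.
by rewrite (le_trans (op_normP f x))// f0 mul0r.
Qed.

HB.instance Definition _ :=
  Lmodule_isNormed.Build R blin op_normD op_normZ op_norm0_eq0.

Lemma blin_normE (f : blin) : `|f| = op_norm f.
Proof. by []. Qed.

End BoundedLinear.

Arguments blin {R} V W.

Section Dual.
Context {R : realType}.

Definition dual (V : normedModType R) : normedModType R := blin V R^o.

(* The canonical isometry of X into its bidual is onto. *)
Definition reflexive_space (X : normedModType R) : Prop :=
  forall phi : dual (dual X), exists x : X, forall f : dual X, phi f = f x.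

Lemma adjoint_subproof (X Y : normedModType R) (A : blin X Y) (l : dual Y) :
  (l : Y -> R) \o A \in @blin_pred R X R^o.
Proof.
apply/asboolP; split; first by move=> a x y /=; rewrite !linearP.
move=> r; have [M AM] := blin_bounded A r; have [N lN] := blin_bounded l M.
by exists N => x xr; apply: lN; exact: AM.
Qed.

Definition adjoint (X Y : normedModType R) (A : blin X Y) (l : dual Y) :
  dual X := BLin (adjoint_subproof A l).

Definition weak_cvg (X : normedModType R) (x : nat -> X) (x0 : X) : Prop :=
  forall f : dual X, (fun k => f (x k) : R) @ \oo --> (f x0 : R).

Definition weak_star_cvg (X : normedModType R) (v : nat -> dual X)
    (v0 : dual X) : Prop :=
  forall x : X, (fun k => v k x : R) @ \oo --> (v0 x : R).

(* M(x, r) for the constraint A x = b; as C = X and K = {0}, the normal cone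
   component vanishes and y ranges over y = 0 only. *)
Definition Mset (X Y : normedModType R) (A : blin X Y) (b : Y) (x : X) (r : R) :
    set (dual X) :=
  [set adjoint A l | l in [set l : dual Y | - (l (A x - b) : R) <= r]].

(* Regularity is meant at feasible points; A xbar = b is not part of the
   predicate and has to be assumed separately. *)
Definition w_AKKT_regular (X Y : normedModType R) (A : blin X Y) (b : Y)
    (xbar : X) : Prop :=
  forall vbar : dual X,
    (exists (x : nat -> X) (r : nat -> R) (v : nat -> dual X),
       [/\ forall k, 0 <= r k,
           weak_cvg x xbar,
           r @ \oo --> (0 : R),
           weak_star_cvg v vbar
         & forall k, Mset A b (x k) (r k) (v k)]) ->
    Mset A b xbar 0 vbar.

End Dual.

(* Main.v *)
(* If A^* l_k converges weakly* to vbar, the functionals l_k converge pointwise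
   on range A, which is a Banach space since it is closed; by the uniform
   boundedness principle there is C with |l_k y| <= C |y| for all k and all y in
   range A. In the limit |vbar x| <= C |A x|, so vbar factors through A by a
   bounded functional on range A, which Hahn-Banach extends to Y. *)

Require Import Defs.
From HB Require Import structures.
From mathcomp Require Import all_boot all_order all_algebra.
From mathcomp Require Import all_classical all_reals topology normedtype sequences.

Import Order.TTheory GRing.Theory Num.Theory.
Import numFieldNormedType.Exports.

Local Open Scope classical_set_scope.
Local Open Scope ring_scope.

(** * Sublinear functionals and the Hahn-Banach theorem *)

Section Sublinear.
Context {R : realType} {V : lmodType R}.
Implicit Types (p q f g : V -> R) (F : set (V -> R)).

(** Only [<=] is asked of positive homogeneity, which is easier to check for infima; equality
    follows by scaling back with the inverse. *)
Definition sublinear p : Prop :=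
  (forall x y, p (x + y) <= p x + p y) /\
  (forall a x, 0 < a -> p (a *: x) <= a * p x).

Lemma sublinearZ {p a} x : sublinear p -> 0 < a -> p (a *: x) = a * p x.
Proof.
move=> [_ pZ] a0; apply/eqP; rewrite eq_le pZ//= -ler_pdivlMl//.
by rewrite -{1}[x](scalerK (lt0r_neq0 a0)) pZ ?invr_gt0.
Qed.

Lemma sublinear0 p : sublinear p -> p 0 = 0.
Proof.
move=> sp; have := sublinearZ 0 sp (ltr0Sn R 1).
rewrite scaler0 mulr_natl mulr2n => /eqP.
by rewrite -subr_eq0 opprD addNKr oppr_eq0 => /eqP.
Qed.

Lemma sublinear_ge p x : sublinear p -> - p (- x) <= p x.
Proof.
move=> sp; rewrite lerNl -subr_ge0 opprK addrC -(sublinear0 _ sp) -(subrr x).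
by case: sp.
Qed.

Definition inf_fun F x : R := inf [set f x | f in F].

Lemma inf_fun_le F f x :
  has_lbound [set f x | f in F] -> F f -> inf_fun F x <= f x.
Proof. by move=> lF Ff; apply: ge_inf => //; exists f. Qed.

Lemma le_inf_fun F c x :
  F !=set0 -> (forall f, F f -> c <= f x) -> c <= inf_fun F x.
Proof.
move=> [f Ff] cF; apply: lb_le_inf; first by exists (f x), f.
by move=> _ [g Fg <-]; exact: cF.
Qed.

(** Since [h] may depend on the points, this covers both chains, where the smaller function serves,
    and parametrized families. *)
Lemma inf_fun_sublinear F : F !=set0 ->
  (forall x, has_lbound [set f x | f in F]) ->
  (forall f g x y, F f -> F g -> exists2 h, F h & h (x + y) <= f x + g y) ->
  (forall f a x, F f -> 0 < a -> exists2 h, F h & h (a *: x) <= a * f x) ->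
  sublinear (inf_fun F).
Proof.
move=> F0 lF FD FZ.
split=> [x y|a x a0].
- rewrite -lerBlDr; apply: le_inf_fun => // f Ff.
  rewrite lerBlDr -lerBlDl; apply: le_inf_fun => // g Fg.
  rewrite lerBlDl; have [h Fh hfg] := FD f g x y Ff Fg.
  exact: le_trans (inf_fun_le _ _ _ (lF _) Fh) hfg.
- rewrite -ler_pdivrMl//; apply: le_inf_fun => // f Ff; rewrite ler_pdivrMl//.
  have [h Fh hf] := FZ f a x Ff a0.
  exact: le_trans (inf_fun_le _ _ _ (lF _) Fh) hf.
Qed.

(** Zorn's lemma on the sublinear functionals below [p], ordered so that going up means pointwise
    smaller; a nonempty chain is bounded by its infimum. *)
Lemma minimal_sublinear p : sublinear p ->
  exists q, [/\ sublinear q, forall x, q x <= p x &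
    forall r, sublinear r -> (forall x, r x <= q x) -> r = q].
Proof.
move=> sp; pose T := {q | sublinear q /\ forall x, q x <= p x}.
pose ge (s t : T) : bool := `[< forall x, sval t x <= sval s x >].
have [|r s t /asboolP rs /asboolP st|[s Hs] [t Ht] /asboolP st /asboolP ts|
      A Atot|[q [sq qp]] qmin] := @Zorn T ge.
- by move=> t; apply/asboolP.
- by apply/asboolP => x; exact: le_trans (st x) (rs x).
- apply: eq_exist; apply/funext => x; apply/eqP.
  by rewrite eq_le; apply/andP; split; [exact: ts|exact: st].
- have [[s0 As0]|A0] := pselect (A !=set0); last first.
    (* The empty chain is bounded by [p] itself. *)
    exists (exist _ p (conj sp (fun=> lexx _))) => s As.
    by case: A0; exists s.
  pose F : set (V -> R) := [set sval s | s in A].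
  have lF x : has_lbound [set f x | f in F].
    (* Each [s] in the chain satisfies [- p (- x) <= - s (- x) <= s x]. *)
    exists (- p (- x)) => _ [_ [[s [ss sp']] As <-] <-] /=.
    by rewrite (le_trans _ (sublinear_ge _ x ss))// lerN2.
  have sF : sublinear (inf_fun F).
    apply: inf_fun_sublinear => //.
    + by exists (sval s0), s0.
    + move=> _ _ x y [s As <-] [t At <-].
      have [/asboolP st|/asboolP ts] := Atot _ _ As At.
      * exists (sval t); first by exists t.
        have [[tD _] _] := svalP t.
        by rewrite (le_trans (tD x y))// lerD.
      * exists (sval s); first by exists s.
        have [[sD _] _] := svalP s.
        by rewrite (le_trans (sD x y))// lerD.
    + move=> _ a x [s As <-] a0; exists (sval s); first by exists s.
      by have [[_ sZ] _] := svalP s; exact: sZ.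
  have Fp x : inf_fun F x <= p x.
    have [_ s0p] := svalP s0.
    by apply: le_trans (s0p x); apply: inf_fun_le => //; exists s0.
  exists (exist _ (inf_fun F) (conj sF Fp)) => s As; apply/asboolP => x /=.
  by apply: inf_fun_le => //; exists s.
- exists q; split=> // r sr rq.
  have rp x : r x <= p x by exact: le_trans (rq x) (qp x).
  by have [] := qmin (exist _ r (conj sr rp)) (asboolT rq).
Qed.

(* A minimal sublinear functional is additive: minimality applied to the
   sublinear functional x |-> inf_(t > 0) (q (x + t y) - t q y) <= q gives
   q x <= q (x + y) - q y. *)
Lemma minimal_sublinear_linear q : sublinear q ->
  (forall r, sublinear r -> (forall x, r x <= q x) -> r = q) ->
  linear (q : V -> R^o).
Proof.
move=> sq qmin; have [qD qZ] := sq.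
have qDE x y : q (x + y) = q x + q y.
  apply/eqP; rewrite eq_le qD/=.
  pose F : set (V -> R) :=
    [set (fun x => q (x + t *: y) - t * q y) | t in [set t | 0 < t]].
  have lF z : has_lbound [set f z | f in F].
    (* Indeed [t * q y = q (t *: y) <= q (z + t *: y) + q (- z)]. *)
    exists (- q (- z)) => _ [_ [t /= t0 <-] <-].
    rewrite -(sublinearZ y sq t0) lerBrDr addrC lerBlDr addrC.
    by rewrite -{1}(addKr z (t *: y)) addrC (le_trans (qD _ _))// addrC.
  have sF : sublinear (inf_fun F).
    apply: inf_fun_sublinear => //.
    + by eexists; exists 1 => //=.
    + move=> _ _ z w [s /= s0 <-] [t /= t0 <-]; eexists.
        by exists (s + t) => //=; exact: addr_gt0.
      rewrite /= mulrDl opprD addrACA lerD2r scalerDl addrACA; exact: qD.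
    + move=> _ a z [t /= t0 <-] a0; eexists.
        by exists (a * t) => //=; exact: mulr_gt0.
      by rewrite /= mulrBr mulrA lerD2r -scalerA -scalerDr qZ.
  have F1 : F (fun x => q (x + 1 *: y) - 1 * q y) by exists 1 => //=.
  have Fq z : inf_fun F z <= q z.
    rewrite (le_trans (inf_fun_le _ _ _ (lF z) F1))//= scale1r mul1r.
    by rewrite lerBlDr qD.
  rewrite -lerBrDr -{1}(qmin _ sF Fq).
  by rewrite (le_trans (inf_fun_le _ _ _ (lF x) F1))//= scale1r mul1r.
have qN x : q (- x) = - q x.
  by apply/eqP; rewrite -addr_eq0 -qDE addNr sublinear0.
move=> a x y; rewrite qDE; congr (_ + _).
have [a0|a0|->] := ltgtP a 0; last by rewrite !scale0r sublinear0.
- rewrite -[in LHS](opprK a) scaleNr qN sublinearZ ?oppr_gt0//.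
  by rewrite mulNr opprK.
- exact: sublinearZ.
Qed.

(** No subspace appears: values to be extended are built into the choice of [p]. *)
Theorem Hahn_Banach_sublinear p : sublinear p ->
  exists f : V -> R, linear (f : V -> R^o) /\ forall x, f x <= p x.
Proof.
move=> /minimal_sublinear[q [sq qp qmin]].
by exists q; split=> //; exact: minimal_sublinear_linear.
Qed.

End Sublinear.

(** * Uniform boundedness on a closed subspace *)

Section ClosedSubspace.
Context {R : realType} {V : completeNormedModType R}.

(* The closedness proof is a parameter of the type so that the completeness
   instance can be inferred. *)
Record closed_subspace (S : submodClosed V) (cS : closed [set x | x \in S]) :=
  ClosedSubspace { subspace_val :> V; _ : subspace_val \in S }.

Context (S : submodClosed V) (cS : closed [set x | x \in S]).

HB.instance Definition _ := [isSub for @subspace_val S cS].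
HB.instance Definition _ := [Choice of closed_subspace S cS by <:].
HB.instance Definition _ :=
  [SubChoice_isSubLmodule of closed_subspace S cS by <:].

Let norm (x : closed_subspace S cS) : R := `|val x|.

Let normD x y : norm (x + y) <= norm x + norm y.
Proof. exact: ler_normD. Qed.

Let normZ (a : R) x : norm (a *: x) = `|a| * norm x.
Proof. exact: normrZ. Qed.

Let norm_eq0 x : norm x = 0 -> x = 0.
Proof. by move=> /normr0_eq0 x0; exact: val_inj. Qed.

HB.instance Definition _ :=
  Lmodule_isNormed.Build R (closed_subspace S cS) normD normZ norm_eq0.

(** The inclusion is isometric, so a Cauchy filter has a limit in [V], which stays in [S] by
    closedness. *)
Let subspace_complete (F : set_system (closed_subspace S cS)) :
  ProperFilter F -> cauchy F -> cvg F.
Proof.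
move=> FF /cauchy_ballP cF.
have : cauchy (val @ F).
  apply/cauchy_ballP => e e0; rewrite near_map2.
  apply: filterS (cF e e0) => -[x y] /=.
  by rewrite -!ball_normE.
move=> /cauchy_cvg/cvg_ex[y Fy].
have Sy : y \in S.
  by apply: (closed_cvg _ cS _ _ Fy); apply: nearW => x; exact: valP.
apply/cvg_ex; exists (ClosedSubspace S cS y Sy); apply/cvgrPdist_lt => e e0.
by move/cvgrPdist_lt : Fy => /(_ e e0).
Qed.

HB.instance Definition _ :=
  Uniform_isComplete.Build (closed_subspace S cS) subspace_complete.
(** The restrictions to the Banach space [S] are uniformly bounded on its unit ball; homogeneity
    gives the bound elsewhere. *)
Lemma Banach_Steinhaus_closed_subspace (F : set (dual V)) :
  (forall y, y \in S -> exists M, forall f, F f -> `|f y| <= M) ->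
  exists2 C, 0 <= C & forall f y, F f -> y \in S -> `|f y| <= C * `|y|.
Proof.
pose U : completeNormedModType R := closed_subspace S cS.
pose G : set (U -> R^o) := [set (fun y => f (val y)) | f in F].
move=> Fpt.
have [_ [f Ff <-]|y|C CP] := @Banach_Steinhauss R U R^o G _ _ 1.
- split=> [r|a x y]; last exact: linearP.
  by have [M fM] := blin_bounded f r; exists M => x xr; exact: fM.
- have [M FM] := Fpt _ (valP y); exists M => _ [f Ff <-]; exact: FM.
exists `|C| => // f y Ff Sy.
have [->|y0] := eqVneq y 0; first by rewrite linear0 !normr0 mulr0.
rewrite -ler_pdivrMr ?normr_gt0// mulrC.
rewrite -[X in X * _](ger0_norm (_ : 0 <= `|y|^-1)) ?invr_ge0// -normrZ -linearZ.
have SZ : `|y|^-1 *: y \in S by exact: rpredZ.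
apply: le_trans (ler_norm C).
apply: (CP (fun y => f (val y)) _ (ClosedSubspace S cS _ SZ : U)).
  by exists f.
by rewrite /Num.norm/= /norm /= normrZ normfV normr_id mulVf ?normr_eq0.
Qed.

End ClosedSubspace.

(** * Factoring a functional through an operator *)

Section Factorization.
Context {R : realType} {X Y : normedModType R}.
Implicit Types (A : blin X Y) (v : dual X).

(* The sublinear functional y |-> inf_x (v x + C |y - A x|) is at most C |y|
   (take x = 0) and at most v x at A x, so any linear minorant is bounded and
   agrees with v on the range of A. *)
Lemma dual_factor A v C : 0 <= C ->
  (forall x, `|v x| <= C * `|A x|) -> exists l : dual Y, adjoint A l = v.
Proof.
move=> C0 vA.
pose g x (y : Y) : R := v x + C * `|y - A x|.
pose F : set (Y -> R) := range g.
have lF y : has_lbound [set f y | f in F].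
  (* Here [- v x <= C * |A x| <= C * |y - A x| + C * |y|]. *)
  exists (- (C * `|y|)) => _ [_ [x _ <-] <-].
  rewrite lerNl opprD lerBlDr -mulrDr.
  rewrite (le_trans (ler_norm _))// normrN (le_trans (vA x))//.
  rewrite ler_wpM2l// -[in leLHS](subrK y (A x)) addrC.
  by rewrite (le_trans (ler_normD _ _))// distrC.
have sF : sublinear (inf_fun F).
  apply: inf_fun_sublinear => //.
  - by exists (g 0), 0.
  - move=> _ _ y z [x _ <-] [w _ <-]; exists (g (x + w)).
      by exists (x + w).
    rewrite /g (linearD v) (linearD A) addrACA lerD2l -mulrDr ler_wpM2l//.
    by rewrite opprD addrACA ler_normD.
  - move=> _ a y [x _ <-] a0; exists (g (a *: x)).
      by exists (a *: x).
    rewrite /g (linearZ_LR v) (linearZ_LR A)/= -scalerBr normrZ gtr0_norm//.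
    by rewrite mulrDr mulrCA.
have [l [ll lF']] := Hahn_Banach_sublinear _ sF.
have lg x y : l y <= g x y.
  by apply: le_trans (lF' y) _; apply: inf_fun_le => //; exists x.
have lN y : l (- y) = - l y.
  pose L : {linear Y -> R^o} := HB.pack l (GRing.isLinear.Build _ _ _ _ _ ll).
  exact: (linearN L).
have lC y : `|l y| <= C * `|y|.
  have le z : l z <= C * `|z|.
    by have := lg 0 z; rewrite /g (linear0 v) (linear0 A) add0r subr0.
  by rewrite ler_norml le andbT lerNl -lN -normrN le.
have lv x : l (A x) <= v x.
  by have := lg x (A x); rewrite /g subrr normr0 mulr0 addr0.
have lP : (l : Y -> R^o) \in @blin_pred R Y R^o.
  apply/asboolP; split=> // r; exists (C * r) => y yr.
  by rewrite (le_trans (lC y))// ler_wpM2l.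
exists (BLin lP); apply: blin_ext => x /=; apply/eqP; rewrite eq_le lv/=.
(* The reverse inequality is [lv] at [- x]. *)
by rewrite -lerN2 -lN -!linearN lv.
Qed.

End Factorization.

(** * The range as a submodule *)

Section RangeSubmod.
Context {R : realType} {X Y : normedModType R} (A : blin X Y).

Definition blin_range : {pred Y} := [pred y | `[< range A y >]].

Let blin_range_submod : submod_closed blin_range.
Proof.
split=> [|a _ _ /asboolP[x _ <-] /asboolP[y _ <-]]; apply/asboolP.
  by exists 0 => //; rewrite linear0.
by exists (a *: x + y) => //; rewrite linearP.
Qed.

HB.instance Definition _ :=
  GRing.isSubmodClosed.Build R Y blin_range blin_range_submod.

End RangeSubmod.

(** * Regularity at feasible points *)

Theorem mainTheorem9 (R : realType) (X Y : completeNormedModType R)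
    (A : blin X Y) (b : Y) :
  reflexive_space X ->
  closed (range A) ->
  forall xbar : X, A xbar = b -> w_AKKT_regular A b xbar.
Proof.
move=> _ cA xbar Axb vbar [x [r [v [_ _ _ v_vbar vM]]]].
(* The residual at [xbar] is zero, so every [l] meets the inequality in [Mset]. *)
suff [l lv] : exists l : dual Y, adjoint A l = vbar.
  by exists l => //=; rewrite Axb subrr linear0 oppr0.
have /choice[l vE] : forall k, exists l : dual Y, adjoint A l = v k.
  by move=> k; have [l _ lv] := vM k; exists l.
have cS : closed [set y | y \in blin_range A].
  rewrite (_ : [set _ | _] = range A)//; apply/seteqP.
  by split=> y => [/asboolP|Ay]; last exact/asboolP.
have lpt y : y \in blin_range A ->
    exists M, forall f, range l f -> `|f y| <= M.
  move=> /asboolP[z _ <-].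
  (* A convergent real sequence is bounded, and [l k (A z) = v k z]. *)
  have /cvg_seq_bounded : cvgn (fun k => v k z : R).
    by apply/cvg_ex; exists (vbar z); exact: v_vbar.
  move=> /pinfty_ex_gt0[M _ vM']; exists M => _ [k _ <-].
  by have : `|v k z| <= M := vM' k Logic.I; rewrite -vE.
have [C C0 lC] := @Banach_Steinhaus_closed_subspace _ _ _ cS _ lpt.
apply: (dual_factor _ _ _ C0) => z.
(* Pass to the limit in [|v k z| <= C * |A z|]. *)
have /cvg_norm vz := v_vbar z.
apply: (cvgr_to_le vz); apply: nearW => k; rewrite -vE.
by apply: lC; [exists k|apply/asboolP; exists z].
Qed.
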